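(* Let $G$ be a simple graph of order $n$. Then the strong alliance polynomial $a(G;x)$ and the defensive alliance polynomial $da(G;x,y)$ satisfy $$a(G;x) = \sum_{k=0}^{n-1}[y^{n+k}]\,da(G;x,y).$$
   Context: All graphs are finite, simple and have at least one vertex. For a graph $G$, $S\subseteq V(G)$ and $u\in V(G)$, let $\bar S=V(G)\setminus S$, let $\delta_S(u)=|\{v\in S:\{u,v\}\in E(G)\}|$, and let $G[S]$ be the subgraph induced by $S$. The defensive alliance polynomial of $G$ is $$da(G;x,y)=\sum_{S} x^{|S|}\,y^{f_y(S)},\qquad f_y(S)=\min_{u\in S}\bigl(\delta_S(u)-\delta_{\bar S}(u)+|V(G)|\bigr),$$ where the sum runs over all non-empty $S\subseteq V(G)$ such that $G[S]$ is connected (single-vertex graphs are connected). $[y^l]\,da(G;x,y)$ denotes the coefficient of $y^l$ in $da(G;x,y)$, which is a polynomial in $x$. A non-empty set $S\subseteq V(G)$ is a strong defensive alliance if $\delta_S(v)-\delta_{\bar S}(v)\ge 0$ for all $v\in S$. The strong alliance polynomial is $a(G;x)=\sum_S x^{|S|}$, where the sum runs over all non-empty $S\subseteq V(G)$ such that $G[S]$ is connected and $S$ is a strong defensive alliance. *)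

(* Defs.v *)
From HB Require Import structures.
From mathcomp Require Import all_boot all_order all_algebra.
Set Implicit Arguments.
Unset Strict Implicit.
Unset Printing Implicit Defensive.
Import Order.TTheory GRing.Theory Num.Theory.
Local Open Scope ring_scope.

(* A finite simple graph is a finType V with a symmetric and irreflexive      *)
(* adjacency relation e : rel V; the two properties are hypotheses of the     *)
(* results that concern simple graphs.                                        *)

Definition deg_in (V : finType) (e : rel V) (S : {set V}) (u : V) : nat :=
  #|[set v in S | e u v]|.

(* The integer delta_S(u) - delta_(~S)(u). *)
Definition deg_diff (V : finType) (e : rel V) (S : {set V}) (u : V) : int :=
  (deg_in e S u)%:Z - (deg_in e (~: S) u)%:Z.

Definition induced (V : finType) (e : rel V) (S : {set V}) : rel V :=
  [rel u v | [&& u \in S, v \in S & e u v]].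

(* This also holds of set0; non-emptiness is always required separately. *)
Definition induced_connected (V : finType) (e : rel V) (S : {set V}) : bool :=
  [forall u in S, forall v in S, connect (induced e S) u v].

(* The default value 2|V| bounds every term, so that for S != set0 this is    *)
(* the minimum over S (fyS_min, fyS_attained); it is then positive            *)
(* (fyS_gt0), so it is faithfully represented by the exponent `|fyS e S|%N.   *)
Definition fyS (V : finType) (e : rel V) (S : {set V}) : int :=
  \big[Num.min/(2 * #|V|)%N%:Z]_(u in S) (deg_diff e S u + #|V|%:Z).

Definition strong_alliance (V : finType) (e : rel V) (S : {set V}) : bool :=
  (S != set0) && [forall v in S, 0 <= deg_diff e S v].

(* Z[x][y]: the outer indeterminate is y, so (da_poly e)`_l is the            *)
(* coefficient of y^l, a polynomial in x.                                     *)
Definition da_poly (V : finType) (e : rel V) : {poly {poly int}} :=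
  \sum_(S : {set V} | (S != set0) && induced_connected e S)
     ('X^#|S| : {poly int}) *: 'X^`|fyS e S|%N.

Definition a_poly (V : finType) (e : rel V) : {poly int} :=
  \sum_(S : {set V} | [&& S != set0, induced_connected e S
                         & strong_alliance e S]) 'X^#|S|.

Lemma fyS_min (V : finType) (e : rel V) (S : {set V}) (u : V) :
  u \in S -> fyS e S <= deg_diff e S u + #|V|%:Z.
Proof. by move=> uS; rewrite /fyS (bigD1 u) //= ge_min lexx. Qed.

Lemma fyS_attained (V : finType) (e : rel V) (S : {set V}) :
  S != set0 -> exists2 u, u \in S & fyS e S = deg_diff e S u + #|V|%:Z.
Proof.
case/set0Pn=> u0 u0S.
have le2 u : u \in S -> deg_diff e S u + #|V|%:Z <= (2 * #|V|)%N%:Z.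
  move=> _; rewrite /deg_diff mul2n -addnn PoszD lerD2r lerBlDr -PoszD lez_nat.
  exact: leq_trans (max_card _) (leq_addr _ _).
have [u uS def_u] := eq_bigmin u0 (mem S) _ u0S le2.
by exists u.
Qed.

Lemma fyS_gt0 (V : finType) (e : rel V) (S : {set V}) :
  S != set0 -> 0 < fyS e S.
Proof.
move=> S0; have [u uS ->] := fyS_attained e S0; rewrite /deg_diff addrAC subr_gt0 -PoszD ltz_nat.
have lt_deg : (deg_in e (~: S) u < #|V|)%N.
  rewrite -cardsT; apply/proper_card/properP; split; first exact: subsetT.
  by exists u; rewrite ?inE // uS.
exact: leq_trans lt_deg (leq_addl _ _).
Qed.

(* Main.v *)
Require Import Defs.
From mathcomp Require Import all_boot all_order all_algebra.
Import Order.TTheory GRing.Theory Num.Theory.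
Local Open Scope ring_scope.

(** Each non-empty connected [S] contributes ['X^#|S|] to exactly one coefficient in [y], that of
    exponent [fyS e S]. The shift by [n] turns nonnegativity of all degree differences into
    [n <= fyS e S] ([strong_allianceE]), and the absence of loops gives [fyS e S < 2n]
    ([fyS_lt_double]). So the exponents from [n] to [2n - 1] collect exactly the strong alliances;
    exchanging the two sums concludes. *)

Lemma deg_in_lt_card (V : finType) (e : rel V) (S : {set V}) (u : V) :
  irreflexive e -> (deg_in e S u < #|V|)%N.
Proof.
move=> e_irr; rewrite -cardsT; apply/proper_card/properP.
(* The vertex missed is [u], not its own neighbour. *)
by split; [exact: subsetT | exists u; rewrite ?inE // e_irr andbF].
Qed.

Lemma fyS_lt_double (V : finType) (e : rel V) (S : {set V}) :
  irreflexive e -> S != set0 -> fyS e S < (#|V| + #|V|)%N%:Z.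
Proof.
move=> e_irr /(fyS_attained e)[u _ ->]; rewrite PoszD ltrD2r /deg_diff.
(* Dropping the outside degree only increases the difference. *)
apply: le_lt_trans (_ : (deg_in e S u)%:Z < _); first by rewrite gerBl.
by rewrite ltz_nat deg_in_lt_card.
Qed.

Lemma strong_allianceE (V : finType) (e : rel V) (S : {set V}) :
  S != set0 -> strong_alliance e S = (#|V|%:Z <= fyS e S).
Proof.
move=> S0; rewrite /strong_alliance S0 /=.
apply/forall_inP/idP => [ge0 | le_f v vS].
  by have [u uS ->] := fyS_attained e S0; rewrite lerDr ge0.
by have := le_trans le_f (fyS_min e vS); rewrite lerDr.
Qed.

Lemma coef_da_poly (V : finType) (e : rel V) (l : nat) :
  (da_poly e)`_l =
  \sum_(S : {set V} | (S != set0) && induced_connected e S)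
     if l == `|fyS e S|%N then 'X^#|S| else 0.
Proof.
rewrite coef_sum; apply: eq_bigr => S _.
by rewrite coefZ coefXn; case: eqP => _; rewrite ?mulr1 ?mulr0.
Qed.

(** Only [k = f - m] can contribute; the bound on [f] keeps it below [n]. *)
Lemma sum_shifted_indicator (R : nmodType) (a : R) (m n f : nat) :
  (f < m + n)%N ->
  \sum_(0 <= k < n) (if (m + k)%N == f then a else 0) =
  if (m <= f)%N then a else 0.
Proof.
move=> lt_f; case: leqP => [le_m | lt_m].
  have lt_fm : (f - m < n)%N by rewrite ltn_subLR.
  rewrite big_mkord (bigD1 (Ordinal lt_fm)) //= subnKC // eqxx big1 ?addr0 //.
  move=> k /eqP neq_k; case: eqP => // eq_f; case: neq_k; apply/val_inj => /=.
  by rewrite -eq_f addKn.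
by apply: big1 => k _; case: eqP => // eq_f; rewrite -eq_f ltnNge leq_addr in lt_m.
Qed.

Theorem proposition5 (V : finType) (e : rel V)
    (e_sym : symmetric e) (e_irr : irreflexive e)
    (n : nat) (n_gt0 : (0 < n)%N) (order_n : #|V| = n) :
  a_poly e = \sum_(0 <= k < n) (da_poly e)`_(n + k).
Proof.
under eq_bigr do rewrite coef_da_poly.
rewrite exchange_big /= /a_poly.
(* The alliance condition becomes an [if], so both sides range over the same sets [S] and can be
   compared termwise. *)
rewrite (eq_bigl _ _ (fun S => andbA _ _ _)) big_mkcondr /=; apply: eq_bigr => S /andP[S0 _].
(* Positivity identifies the integer minimum with the natural exponent in [da_poly]. *)
have fE : fyS e S = `|fyS e S|%N by rewrite gez0_abs // ltW // fyS_gt0.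
have := @fyS_lt_double _ e S e_irr S0.
by rewrite strong_allianceE // fE order_n ltz_nat lez_nat => /sum_shifted_indicator ->.
Qed.
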